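(* Let $n\ge 1$, $\alpha>0$, $\lambda>0$, let $D=\operatorname{diag}(d_1,\ldots,d_n)$ be a positive definite diagonal matrix (i.e. $d_i>0$ for all $i$), and let $h(x)=\lambda\|x\|_2$ on $\mathbb{R}^n$. The weighted proximal operator of $h$ is given, for every $x\in\mathbb{R}^n$ and every $i\in\{1,\dots,n\}$, by $$\big[\operatorname{prox}_{\alpha h}^{D}(x)\big]_i=\begin{cases}\dfrac{d_i\theta^\star x_i}{d_i\theta^\star+\alpha\lambda} & \text{if } \|Dx\|_2>\alpha\lambda,\\[1em] 0 & \text{otherwise,}\end{cases}$$ where (in the case $\|Dx\|_2>\alpha\lambda$) $\theta^\star>0$ is the unique positive solution of $$\sum_{i=1}^n\left[\frac{d_ix_i}{d_i\theta^\star+\alpha\lambda}\right]^2=1.$$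
   Context: For a positive definite matrix $D$, $\|z\|_D^2=\langle z,Dz\rangle$. The weighted proximal operator of a function $h:\mathbb{R}^n\to\mathbb{R}$ with step size $\alpha>0$ is $$\operatorname{prox}_{\alpha h}^{D}(x)=\operatorname*{argmin}_{z\in\mathbb{R}^n}\ \tfrac12\|z-x\|_D^2+\alpha h(z).$$ *)

(* Defs.v *)
From HB Require Import structures.
From mathcomp Require Import all_boot all_order all_algebra.
From mathcomp Require Import boolp classical_sets reals.

Set Implicit Arguments.
Unset Strict Implicit.
Unset Printing Implicit Defensive.

Import Order.TTheory GRing.Theory Num.Theory.

Local Open Scope classical_set_scope.
Local Open Scope ring_scope.

Definition dot (R : realType) (n : nat) (u v : 'cV[R]_n) : R :=
  \sum_(i < n) u i 0 * v i 0.

(* Not `|x|, which is the max norm on matrices in MathComp-Analysis. *)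
Definition norm2 (R : realType) (n : nat) (x : 'cV[R]_n) : R :=
  Num.sqrt (dot x x).

Definition sqnormD (R : realType) (n : nat) (D : 'M[R]_n) (z : 'cV[R]_n) : R :=
  dot z (D *m z).

Definition argmin (R : realType) (T : Type) (F : T -> R) : set T :=
  [set z | forall w, F z <= F w].

(* The argmin is kept as a set: "prox(x) = p" reads [prox D alpha h x = [set p]],
   i.e. p is a minimizer and the only one. *)
Definition prox (R : realType) (n : nat) (D : 'M[R]_n) (alpha : R)
    (h : 'cV[R]_n -> R) (x : 'cV[R]_n) : set 'cV[R]_n :=
  argmin (fun z => 2^-1 * sqnormD D (z - x) + alpha * h z).

(* Main.v *)
(** Writing mu = alpha lambda, the objective F is quadratic plus mu |.|_2, so
    p is optimal iff D (x - p) = mu g for a subgradient g of |.|_2 at p, that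
    is |g| <= 1 and <g, p> = |p|; completing the square then gives
    F w >= F p + |w - p|_D^2 / 2, hence uniqueness.  For |D x| <= mu take p = 0
    and g = D x / mu.  Otherwise take p = theta g with
    g_i = d_i x_i / (d_i theta + mu); the equation for theta says |g| = 1, and
    its left-hand side decreases strictly from |D x|^2 / mu^2 > 1 at theta = 0
    to at most 1 at theta = |x|. *)

Require Import Defs.
From HB Require Import structures.
From mathcomp Require Import all_boot all_order all_algebra.
From mathcomp Require Import boolp classical_sets reals.
From mathcomp Require Import topology normedtype realfun ring lra.

Set Implicit Arguments.
Unset Strict Implicit.
Unset Printing Implicit Defensive.

Import Order.TTheory GRing.Theory Num.Theory numFieldNormedType.Exports.

Local Open Scope classical_set_scope.
Local Open Scope ring_scope.

Lemma dot_ge0 (R : realType) (n : nat) (u : 'cV[R]_n) : 0 <= dot u u.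
Proof. by apply: sumr_ge0 => i _; rewrite -expr2 sqr_ge0. Qed.

Lemma norm2_ge0 (R : realType) (n : nat) (u : 'cV[R]_n) : 0 <= norm2 u.
Proof. exact: sqrtr_ge0. Qed.

Lemma sqr_norm2 (R : realType) (n : nat) (u : 'cV[R]_n) :
  norm2 u ^+ 2 = dot u u.
Proof. by rewrite sqr_sqrtr ?dot_ge0. Qed.

Lemma dot_eq0 (R : realType) (n : nat) (u : 'cV[R]_n) : dot u u = 0 -> u = 0.
Proof.
move=> u0; apply/colP => i; rewrite mxE; apply/eqP; rewrite -sqrf_eq0 expr2.
by apply/eqP/(psumr_eq0P _ u0) => // j _; rewrite -expr2 sqr_ge0.
Qed.

Lemma norm2Z (R : realType) (n : nat) (a : R) (u : 'cV[R]_n) :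
  norm2 (a *: u) = `|a| * norm2 u.
Proof.
rewrite /norm2 -sqrtr_sqr -sqrtrM ?sqr_ge0// /dot mulr_sumr; congr Num.sqrt.
by apply: eq_bigr => i _; rewrite !mxE; ring.
Qed.

(** Cauchy-Schwarz, obtained by expanding the square of [norm2 w *: g - w] and dividing by
    [norm2 w]; hence the separate case of a zero norm. *)
Lemma dot_le_norm2 (R : realType) (n : nat) (g w : 'cV[R]_n) :
  norm2 g <= 1 -> dot g w <= norm2 w.
Proof.
move=> g1.
have [w0|w_neq0] := eqVneq (norm2 w) 0.
  have -> : w = 0 by apply: dot_eq0; rewrite -sqr_norm2 w0 expr0n.
  by rewrite /dot big1 ?norm2_ge0// => i _; rewrite mxE mulr0.
have wgt0 : 0 < norm2 w by rewrite lt_def w_neq0 norm2_ge0.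
have gg1 : dot g g <= 1 by rewrite -sqr_norm2 expr_le1// norm2_ge0.
have sq : dot (norm2 w *: g - w) (norm2 w *: g - w) =
    norm2 w ^+ 2 * dot g g - 2 * norm2 w * dot g w + dot w w.
  rewrite /dot !mulr_sumr -sumrB -big_split/=; apply: eq_bigr => i _.
  by rewrite !mxE; ring.
have := dot_ge0 (norm2 w *: g - w); rewrite sq -(sqr_norm2 w) => sq_ge0.
rewrite -(ler_pM2l wgt0); have := ler_wpM2l (sqr_ge0 (norm2 w)) gg1.
by rewrite mulr1; lra.
Qed.

Lemma sqnormD_diag (R : realType) (n : nat) (d : 'rV[R]_n) (z : 'cV[R]_n) :
  sqnormD (diag_mx d) z = \sum_(i < n) d 0 i * z i 0 ^+ 2.
Proof.
by apply: eq_bigr => i _; rewrite mul_diag_mx mxE; ring.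
Qed.

(** Sufficient optimality condition serving both cases of the theorem, each with its own pair [p],
    [g]. *)
Lemma prox_norm2_subgradient (R : realType) (n : nat) (alpha lambda : R)
    (d : 'rV[R]_n) (x p g : 'cV[R]_n) :
  0 < alpha -> 0 < lambda -> (forall i, 0 < d 0 i) ->
  norm2 g <= 1 -> dot g p = norm2 p ->
  diag_mx d *m (x - p) = (alpha * lambda) *: g ->
  prox (diag_mx d) alpha (fun z => lambda * norm2 z) x = [set p].
Proof.
move=> alpha0 lambda0 d0 g1 gp dxp.
set F := fun z => 2^-1 * sqnormD (diag_mx d) (z - x) + alpha * (lambda * norm2 z).
have gap w : F p + 2^-1 * sqnormD (diag_mx d) (w - p) <= F w.
  (* Split [w - x] as [(w - p) + (p - x)]; stationarity turns the cross term into one in [g]. *)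
  have expand : sqnormD (diag_mx d) (w - x) =
      sqnormD (diag_mx d) (p - x) + sqnormD (diag_mx d) (w - p)
      - 2 * (alpha * lambda) * (dot g w - dot g p).
    rewrite !sqnormD_diag /dot -sumrB mulr_sumr -big_split -sumrB/=.
    apply: eq_bigr => i _.
    have : d 0 i * (x i 0 - p i 0) = alpha * lambda * g i 0.
      by have := congr1 (fun u : 'cV_n => u i 0) dxp; rewrite mul_diag_mx !mxE.
    move=> dxpi; rewrite !mxE.
    (* Once [g] is eliminated, the claim is a polynomial identity. *)
    have -> : 2 * (alpha * lambda) * (g i 0 * w i 0 - g i 0 * p i 0) =
        2 * (d 0 i * (x i 0 - p i 0)) * (w i 0 - p i 0) by rewrite dxpi; ring.
    by ring.
  have gw : alpha * lambda * dot g w <= alpha * lambda * norm2 w.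
    by rewrite ler_pM2l ?mulr_gt0// dot_le_norm2.
  by rewrite /F expand gp; lra.
have sq_ge0 (z : 'cV[R]_n) i : 0 <= d 0 i * z i 0 ^+ 2.
  by rewrite mulr_ge0 ?sqr_ge0// ltW.
apply/seteqP; split=> [z /= zmin|_ -> w] /=; last first.
  apply: le_trans (gap w); rewrite lerDl mulr_ge0 ?invr_ge0// sqnormD_diag.
  exact: sumr_ge0.
(* For another minimizer [z], [F z <= F p] and [gap z] leave no room for a positive weighted
   distance. *)
have zp0 : sqnormD (diag_mx d) (z - p) = 0.
  apply/eqP; rewrite eq_le; apply/andP; split.
    by have := zmin p; have := gap z; rewrite /F; lra.
  by rewrite sqnormD_diag sumr_ge0.
apply/colP => i; apply/eqP; rewrite -subr_eq0.
move: zp0; rewrite sqnormD_diag => /psumr_eq0P zp0.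
have /eqP := zp0 (fun j _ => sq_ge0 (z - p) j) i isT.
by rewrite mulf_eq0 gt_eqF//= sqrf_eq0 !mxE.
Qed.

Section secular_equation.
Variables (R : realType) (n : nat) (mu : R) (d : 'rV[R]_n) (x : 'cV[R]_n).
Hypotheses (mu0 : 0 < mu) (d0 : forall i, 0 < d 0 i).

(** The squared norm of the candidate subgradient, as a function of the unknown [theta]. *)
Definition secular (t : R) := \sum_(i < n) (d 0 i * x i 0 / (d 0 i * t + mu)) ^+ 2.

Lemma secular_den_gt0 t i : 0 <= t -> 0 < d 0 i * t + mu.
Proof. by move=> t0; rewrite ltr_wpDl// mulr_ge0// ltW. Qed.

(** Every term with a nonzero numerator decreases strictly, the others stay zero. The condition
    [secular t != 0] provides at least one of the former. *)
Lemma secular_decreasing s t :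
  0 <= s -> s < t -> secular t != 0 -> secular t < secular s.
Proof.
move=> s0 st seqt.
have t0 : 0 < t by exact: le_lt_trans st.
have lt_term i : d 0 i * x i 0 != 0 ->
    (d 0 i * x i 0 / (d 0 i * t + mu)) ^+ 2 <
    (d 0 i * x i 0 / (d 0 i * s + mu)) ^+ 2.
  move=> dx; rewrite exprMn [ltRHS]exprMn ltr_pM2l; last first.
    by rewrite lt_def sqr_ge0 sqrf_eq0 dx.
  rewrite ltr_pXn2r ?nnegrE ?invr_ge0 ?ltW ?secular_den_gt0// ?(ltW t0)//.
  by rewrite ltf_pV2 ?posrE ?secular_den_gt0// ?(ltW t0)// ltrD2r ltr_pM2l.
have [i dxi] : exists i, d 0 i * x i 0 != 0.
  apply/existsP; apply: contraNT seqt; rewrite negb_exists => /forallP dx.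
  apply/eqP/big1 => i _; have := dx i; rewrite negbK => /eqP ->.
  by rewrite mul0r expr0n.
rewrite /secular (bigD1 i)//= [ltRHS](bigD1 i)//= ltr_leD ?lt_term//.
apply: ler_sum => j _; have [->|dx] := eqVneq (d 0 j * x j 0) 0.
  by rewrite !mul0r.
by rewrite ltW ?lt_term.
Qed.

Lemma secular_solution :
  mu < norm2 (diag_mx d *m x) -> exists2 t, 0 < t & secular t = 1.
Proof.
move=> mu_lt.
have s0_gt1 : 1 < secular 0.
  have -> : secular 0 = (norm2 (diag_mx d *m x) / mu) ^+ 2.
    rewrite expr_div_n sqr_norm2 /dot mulr_suml; apply: eq_bigr => i _.
    by rewrite mul_diag_mx !mxE mulr0 add0r expr_div_n expr2.
  by rewrite expr_gt1 ?divr_ge0 ?norm2_ge0 ?ltW// ltr_pdivlMr ?mul1r.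
have x_gt0 : 0 < norm2 x.
  rewrite lt_def norm2_ge0 andbT; apply/eqP => x0.
  have x_eq0 : x = 0 by apply: dot_eq0; rewrite -sqr_norm2 x0 expr0n.
  move: s0_gt1; rewrite /secular big1 ?ltr10// => i _.
  by rewrite x_eq0 mxE mulr0 mul0r expr0n.
have sx_le1 : secular (norm2 x) <= 1.
  (* Writing 1 through the unit vector [x / norm2 x] allows a termwise comparison: dropping [mu]
     from the denominator [d 0 i * norm2 x + mu] only enlarges a term. *)
  have -> : 1 = \sum_(i < n) (x i 0 / norm2 x) ^+ 2.
    under eq_bigr do rewrite expr_div_n expr2.
    by rewrite -mulr_suml -/(dot x x) -sqr_norm2 divff ?sqrf_eq0 ?gt_eqF.
  apply: ler_sum => i _; rewrite [d 0 i * _]mulrC -mulrA exprMn [leRHS]exprMn.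
  apply: ler_wpM2l; first exact: sqr_ge0.
  have den0 := secular_den_gt0 i (norm2_ge0 x).
  have norm_inv0 : 0 < (norm2 x)^-1 by rewrite invr_gt0.
  apply: lerXn2r; rewrite ?nnegrE ?divr_ge0 ?(ltW norm_inv0) ?(ltW den0) ?(ltW (d0 i))//.
  rewrite ler_pdivrMr// mulrDr mulrCA mulVf ?gt_eqF// mulr1 lerDl.
  by rewrite mulr_ge0 ?ltW.
(* All denominators are positive on this interval. *)
have cont : {within `[0, norm2 x], continuous secular}.
  apply: continuous_in_subspaceT => t; rewrite inE/= in_itv/= => /andP[t0 _].
  apply: (cvg_big (op := +%R)) => [|i _]; first exact: add_continuous.
  apply: (@continuous_comp _ _ _ (fun s => d 0 i * x i 0 / (d 0 i * s + mu))
    (fun y : R => y ^+ 2)); last exact: exprn_continuous.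
  apply: cvgMl_tmp; apply: cvgV; first by rewrite gt_eqF ?secular_den_gt0.
  by apply: cvgD; [apply: cvgMl_tmp; exact: cvg_id|exact: cvg_cst].
have [] := @IVT R secular 0 (norm2 x) 1 (norm2_ge0 x) cont.
  by rewrite ge_min le_max sx_le1 (ltW s0_gt1) orbT.
move=> t; rewrite in_itv/= => /andP[t0 _] seqt; exists t => //.
rewrite lt_def t0 andbT; apply/eqP => teq0.
by move: s0_gt1; rewrite -teq0 seqt ltxx.
Qed.

End secular_equation.

Theorem theorem1 (R : realType) (n : nat) (hn : (1 <= n)%N)
    (alpha lambda : R) (halpha : 0 < alpha) (hlambda : 0 < lambda)
    (d : 'rV[R]_n) (hd : forall i : 'I_n, 0 < d 0 i) (x : 'cV[R]_n) :
  let D := diag_mx d in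
  let h := fun z : 'cV[R]_n => lambda * norm2 z in
  (alpha * lambda < norm2 (D *m x) ->
     exists theta : R,
       unique (fun t : R => 0 < t /\
         \sum_(i < n) (d 0 i * x i 0 / (d 0 i * t + alpha * lambda)) ^+ 2 = 1)
         theta /\
       prox D alpha h x =
         [set \col_(i < n)
           (d 0 i * theta * x i 0 / (d 0 i * theta + alpha * lambda))]) /\
  (~ (alpha * lambda < norm2 (D *m x)) -> prox D alpha h x = [set 0]).
Proof.
move=> D h; have mu0 : 0 < alpha * lambda by exact: mulr_gt0.
split=> [mu_lt|/negP]; last first.
  rewrite -leNgt => le_mu.
  apply: (@prox_norm2_subgradient _ _ _ _ _ _ _ ((alpha * lambda)^-1 *: (D *m x))) => //.
  - rewrite norm2Z gtr0_norm ?invr_gt0//.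
    by rewrite ler_pdivrMl// mulr1.
  - by rewrite /norm2 /dot !big1 ?sqrtr0// => i _; rewrite !mxE mulr0.
  - by rewrite subr0 scalerA divff ?scale1r// gt_eqF.
have [theta theta0 eqtheta] := secular_solution mu0 hd mu_lt.
rewrite /secular in eqtheta.
exists theta; split.
  (* If two solutions differed, strict decrease between them would give [1 < 1]. *)
  split=> // t [t0 eqt]; apply/eqP; rewrite eq_le; apply/andP; split;
    rewrite leNgt; apply/negP => lt_t.
  - have := secular_decreasing (x := x) mu0 hd (ltW t0) lt_t.
    by rewrite /secular eqtheta eqt ltxx oner_eq0 => /(_ isT).
  - have := secular_decreasing (x := x) mu0 hd (ltW theta0) lt_t.
    by rewrite /secular eqtheta eqt ltxx oner_eq0 => /(_ isT).
pose g := \col_i (d 0 i * x i 0 / (d 0 i * theta + alpha * lambda)).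
have gg : dot g g = 1.
  by rewrite -eqtheta; apply: eq_bigr => i _; rewrite !mxE expr2.
have g1 : norm2 g = 1 by rewrite /norm2 gg sqrtr1.
have -> : \col_i (d 0 i * theta * x i 0 / (d 0 i * theta + alpha * lambda)) =
    theta *: g.
  by apply/colP => i; rewrite !mxE !mulrA [theta * _]mulrC.
apply: (@prox_norm2_subgradient _ _ _ _ _ _ _ g) => //; first by rewrite g1.
  (* Both sides equal [theta], since [g] is a unit vector and [theta] is positive. *)
  rewrite norm2Z g1 gtr0_norm// mulr1 -[RHS]mulr1 -gg /dot mulr_sumr.
  by apply: eq_bigr => i _; rewrite !mxE mulrCA.
(* Stationarity is the defining relation of [g], namely [(d 0 i * theta + alpha * lambda) * g i 0 =
   d 0 i * x i 0], rearranged. *)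
apply/colP => i; rewrite mul_diag_mx !mxE.
by field; rewrite gt_eqF// ltr_wpDl// mulr_ge0 ?ltW.
Qed.
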